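(* Assume that the repository has $n$ packages and no known dependencies ($K=\emptyset$), and contains at most $d$ defects, at most $u$ unknown dependencies and at most $c$ unknown weak conflicts. Any non-adaptive algorithm that solves Full Learning must use at least $\mathcal S_{n,d+c-1,u+2}$ queries.
   Context: A repository consists of a finite set $P$ of $n$ packages, a set $K\subseteq P\times P$ of known dependencies, a set $U\subseteq P\times P$ of unknown dependencies, a set $C$ of unknown conflicts (unordered pairs of distinct packages), and a set $D\subseteq P$ of defects. A pair $(q,p)\in K\cup U$ means that $q$ depends on $p$: any installation including $q$ but not $p$ fails. An installation is a subset $I\subseteq P$; it is successful iff it contains no defect, contains $p$ whenever it contains $q$ with $(q,p)\in K\cup U$, and contains no two packages $p,q$ with $\{p,q\}\in C$. Defects are the packages that cannot be part of any successful installation; thus a package that depends on a defect is itself a defect, i.e. $((P\setminus D)\times D)\cap(K\cup U)=\emptyset$. Given two packages $p,q\in P$, $p$ weakly conflicts with $q$ if no successful installation includes both $p$ and $q$, and $p$ weakly depends on $q$ if no successful installation includes $p$ but not $q$. An algorithm is given $P$, $K$ and the bounds $d,u,c$. A query is an installation $I\subseteq P$; an oracle answers whether it is successful. A non-adaptive algorithm computes its whole set of queries from its input and then computes its output from the answers. The cost is the number of queries. Full Learning: return the mixed graph whose vertices are the strongly connected components of the packages with the defective packages marked, together with all conflicts and all dependencies. Conflicts and dependencies are understood in the weak sense, so this amounts to determining the defects, the pairs of packages that weakly conflict, and the ordered pairs $(p,q)$ such that $p$ weakly depends on $q$. An $(n,a,b)$-cover-free family (CFF) is a set $\mathcal F\subseteq\{0,1\}^n$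 such that for all disjoint $S_1,S_2\subseteq\{1,\dots,n\}$ with $|S_1|=a$, $|S_2|=b$ there is $v\in\mathcal F$ whose entries are all $0$ on $S_1$ and all $1$ on $S_2$. $\mathcal S_{n,a,b}$ denotes the minimal size of an $(n,a,b)$-CFF.
   Formalization: The bound c ≥ 1 is assumed, since the claim fails for c = 0 (e.g. n = 10, d = 2, u = 0, where 8 queries suffice but S_{10,1,2} = 9); the at most c weak conflicts are counted between non-defective packages only. *)

(* Defs.v *)
From mathcomp Require Import all_boot.

Set Implicit Arguments.
Unset Strict Implicit.
Unset Printing Implicit Defensive.

Section CoverFree.

Variable n : nat.

Definition cover_free (a b : nat) (F : {set {ffun 'I_n -> bool}}) : bool :=
  [forall S1 : {set 'I_n}, forall S2 : {set 'I_n},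
     [&& [disjoint S1 & S2], #|S1| == a & #|S2| == b] ==>
     [exists v in F, [forall i in S1, ~~ v i] && [forall i in S2, v i]]].

Lemma cover_free_setT (a b : nat) : cover_free a b setT.
Proof.
apply/forallP => S1; apply/forallP => S2; apply/implyP => /and3P[dS _ _].
apply/existsP; exists [ffun i => i \in S2]; rewrite inE /=.
apply/andP; split; apply/forallP => i; apply/implyP; rewrite ffunE //.
by move=> iS1; rewrite (disjointFr dS).
Qed.

(* The whole cube is always a cover-free family, so the minimum is taken over *)
(* a nonempty collection; it is 0 when a + b > n.                             *)
Definition cff_size (a b : nat) : nat :=
  #|[arg min_(F < [set: {ffun 'I_n -> bool}] | cover_free a b F) #|F| ]|.

Lemma cff_sizeP (a b : nat) :
  (exists2 F, cover_free a b F & #|F| = cff_size a b) /\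
  (forall F, cover_free a b F -> cff_size a b <= #|F|).
Proof.
rewrite /cff_size; case: arg_minnP; first exact: cover_free_setT.
by move=> F Fcff Fmin; split=> //; exists F.
Qed.

End CoverFree.

Section Repositories.

Variable P : finType.

(* A pair (q, p) in known or unknown means that q depends on p. *)
Record repository := Repository {
  known : {set P * P};
  unknown : {set P * P};
  conflicts : {set {set P}};
  defects : {set P}
}.

Definition successful (R : repository) (I : {set P}) : bool :=
  [&& [disjoint I & defects R],
      [forall q, forall p,
         ((q, p) \in known R :|: unknown R) ==> (q \in I) ==> (p \in I)]
    & [forall p, forall q,
         ([set p; q] \in conflicts R) ==> ~~ ((p \in I) && (q \in I))]].

(* The second clause says that the defects are exactly the packages that are  *)
(* part of no successful installation.                                        *)
Definition well_formed (R : repository) : Prop :=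
  (forall e, e \in conflicts R -> #|e| = 2) /\
  (forall p, (p \in defects R) = ~~ [exists I, successful R I && (p \in I)]).

Lemma well_formed_defects_closed (R : repository) : well_formed R ->
  setX (~: defects R) (defects R) :&: (known R :|: unknown R) = set0.
Proof.
move=> [_ defD]; apply/setP => -[q p]; rewrite in_setI in_setX in_set0 in_setC.
apply/negP => /andP[/andP[qD pD] qp]; move: qD.
rewrite defD negbK => /existsP[I /andP[/and3P[dI cI _] qI]].
move/forallP/(_ q)/forallP/(_ p): cI; rewrite qp qI /= => pI.
by rewrite (disjointFr dI pI) in pD.
Qed.

Definition weakly_conflicts (R : repository) (p q : P) : bool :=
  ~~ [exists I, [&& successful R I, p \in I & q \in I]].

Definition weakly_depends (R : repository) (p q : P) : bool :=
  ~~ [exists I, [&& successful R I, p \in I & q \notin I]].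

Definition weak_conflicts (R : repository) : {set {set P}} :=
  [set [set pq.1; pq.2] | pq : P * P &
     (pq.1 != pq.2) && weakly_conflicts R pq.1 pq.2].

Definition weak_dependencies (R : repository) : {set P * P} :=
  [set pq | weakly_depends R pq.1 pq.2].

Definition strong_components (e : rel P) : {set {set P}} :=
  equivalence_partition [rel p q | connect e p q && connect e q p] [set: P].

Record mixed_graph := MixedGraph {
  graph_vertices : {set {set P}};
  graph_defects : {set P};
  graph_conflicts : {set {set P}};
  graph_dependencies : {set P * P}
}.

Definition full_graph (R : repository) : mixed_graph :=
  MixedGraph (strong_components (weakly_depends R)) (defects R)
             (weak_conflicts R) (weak_dependencies R).

Record instance := Instance {
  known_dependencies : {set P * P};
  max_defects : nat;
  max_unknown : nat;
  max_conflicts : nat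
}.

(* A defect weakly conflicts with every package; those pairs carry no         *)
(* information beyond the defect itself, and the bound on the number of weak  *)
(* conflicts concerns pairs of non-defective packages.                        *)
Definition admissible (x : instance) (R : repository) : Prop :=
  [/\ well_formed R,
      known R = known_dependencies x,
      #|defects R| <= max_defects x,
      #|unknown R| <= max_unknown x
    & #|[set e in weak_conflicts R | [disjoint e & defects R]]|
        <= max_conflicts x].

(* The output sees the repository only through the subset of the queries that *)
(* the oracle declares successful, that is, through the list of answers.      *)
Record nonadaptive_algorithm := NonadaptiveAlgorithm {
  queries : instance -> {set {set P}};
  output : instance -> {set {set P}} -> mixed_graph
}.

Definition solves_full_learning
    (A : nonadaptive_algorithm) (x : instance) : Prop :=
  forall R, admissible x R ->
    output A x [set I in queries A x | successful R I] = full_graph R.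

End Repositories.

(* Main.v *)
(* Given disjoint sets of packages, one with d + c - 1 and one with u + 2
   elements, pick p and q in the second one and let p depend on its other u
   elements. In the first one make d elements defective and let p conflict
   with the other c - 1. Adding the conflict {p, q} gives a second admissible
   repository with a different output, and only the queries that contain the
   second set and avoid the first one have different answers. Hence every
   correct algorithm makes such a query, for every choice of the two sets. *)
Require Import Defs.
From mathcomp Require Import all_boot.

Lemma subset_of_card (T : finType) (A : {set T}) (k : nat) :
  k <= #|A| -> exists2 B : {set T}, B \subset A & #|B| = k.
Proof.
move=> kA; have: 0 < #|[set B : {set T} | (B \subset A) && (#|B| == k)]|.
  by rewrite cards_draws bin_gt0.
by case/card_gt0P => B; rewrite inE => /andP[BA /eqP Bk]; exists B.
Qed.

Lemma disjoint_setsP (T : finType) (A B : {set T}) :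
  reflect (forall x, x \in A -> x \notin B) [disjoint A & B].
Proof.
rewrite disjoint_subset; by apply: (iffP subsetP) => AB x /AB; rewrite inE.
Qed.

Section StarRepository.

Variables (P : finType) (p : P) (D S T : {set P}).

(** Every dependency and every conflict involves the centre [p], so an installation without [p] can
    fail only by containing a defect. *)
Definition star_repository : repository P :=
  Repository set0 [set (p, s) | s in S] [set [set p; t] | t in T] D.

Hypotheses (pS : p \notin S) (pT : p \notin T).
Hypotheses (SD : [disjoint S & D]) (ST : [disjoint S & T]).

Lemma successful_star (I : {set P}) :
  successful star_repository I =
    [disjoint I & D] && ((p \in I) ==> (S \subset I) && [disjoint I & T]).
Proof.
rewrite /successful /=; case: [disjoint I & D] => //=.
apply/andP/implyP => [[dep conf] pI | ok].
  apply/andP; split.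
    apply/subsetP => s sS; move/forallP/(_ p)/forallP/(_ s): dep.
    by rewrite set0U imset_f // pI.
  apply/disjoint_setsP => t tI; apply/negP => tT.
  move/forallP/(_ p)/forallP/(_ t): conf.
  by rewrite (imset_f (fun t => [set p; t])) // pI tI.
split; apply/forallP => x; apply/forallP => y; apply/implyP.
  rewrite set0U => /imsetP[s sS [-> ->]]; apply/implyP => /ok /andP[SI _].
  exact: (subsetP SI).
case/imsetP => t tT exy; apply/negP => /andP[xI yI].
(* Conflicts are unordered, so [x] may be either end; passing through the inclusion of the whole
   pair avoids a case split. *)
have sub : [set p; t] \subset I by rewrite -exy subUset !sub1set xI.
move: sub; rewrite subUset !sub1set => /andP[/ok /andP[_ IT] tI].
by rewrite (disjointFr IT tI) in tT.
Qed.

(** Adding [S] satisfies the dependencies of [p] in case [p] is [x] or [y], and it brings in no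
    defect and no conflict, being disjoint from [D] and [T]. This installation witnesses both that
    non-defects are installable and that there are no hidden weak conflicts. *)
Lemma successful_star_pair (x y : P) : x \notin D -> y \notin D ->
  [set x; y] \notin conflicts star_repository ->
  successful star_repository ([set x; y] :|: S).
Proof.
move=> xD yD /= nxy; rewrite successful_star; apply/andP; split.
  apply/disjoint_setsP => z; rewrite !inE -orbA => /or3P[/eqP-> //|/eqP-> //|zS].
  by rewrite (disjointFr SD zS).
apply/implyP; rewrite subsetUr /= => pI; apply/disjoint_setsP => z zI.
apply: contra nxy => zT; apply/imsetP; exists z => //.
(* Lying in neither [S] nor [{p}], [z] is the element of the pair other than [p], so the pair is the
   conflict [{p, z}]. *)
have /negPf zS : z \notin S by apply/negP => zS; rewrite (disjointFr ST zS) in zT.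
have /negPf zp : z != p by apply: contraNneq pT => <-.
move: pI zI; rewrite !inE (negPf pS) zS !orbF.
by case/orP=> /eqP <-; rewrite zp ?orbF /= => /eqP->; rewrite // setUC.
Qed.

Lemma well_formed_star : well_formed star_repository.
Proof.
split=> [e /imsetP[t tT ->] | x /=].
  have pt : p != t by apply: contraNneq pT => ->.
  by rewrite cards2 pt.
apply/idP/existsPn => [xD I | noI].
  rewrite successful_star; apply/negP.
  by case/andP=> /andP[/disjoint_setsP ID _] /ID; rewrite xD.
(* The degenerate pair [x = y] installs a single non-defect; a singleton is no conflict, because [p]
   is outside [T]. *)
apply/negPn/negP => xD; move: (noI ([set x; x] :|: S)).
rewrite successful_star_pair ?inE ?eqxx //=.
apply/imsetP => -[t tT /setP exx]; move: (exx p) (exx t).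
by rewrite !inE !eqxx !orbb orbT => /eqP<- /eqP tp; move: pT; rewrite -tp tT.
Qed.

Lemma weak_conflicts_star :
  [set e in weak_conflicts star_repository | [disjoint e & D]]
    \subset conflicts star_repository.
Proof.
apply/subsetP => e; rewrite inE => /andP[/imsetP[[x y]]].
rewrite inE /= => /andP[_ nI] -> /disjoint_setsP xyD.
apply: contraR nI => nxy; apply/existsP; exists ([set x; y] :|: S).
by rewrite successful_star_pair ?xyD // !inE !eqxx ?orbT.
Qed.

Lemma admissible_star (d u c : nat) : #|D| <= d -> #|S| <= u -> #|T| <= c ->
  admissible (Instance set0 d u c) star_repository.
Proof.
move=> Dd Su Tc; split=> //; first exact: well_formed_star.
  exact: leq_trans (leq_imset_card _ _) Su.
apply: leq_trans (subset_leq_card weak_conflicts_star) _.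
exact: leq_trans (leq_imset_card _ _) Tc.
Qed.

End StarRepository.

Lemma full_learning_query (d u c : nat) (P : finType)
    (A : nonadaptive_algorithm P) (S1 S2 : {set P}) :
  0 < c -> solves_full_learning A (Instance set0 d u c) ->
  [disjoint S1 & S2] -> #|S1| = d + c - 1 -> #|S2| = u + 2 ->
  exists2 I, I \in queries A (Instance set0 d u c)
    & [disjoint I & S1] && (S2 \subset I).
Proof.
set x := Instance _ _ _ _ => c0 solA S12 cS1 cS2.
have /card_gt1P[p [q [pS2 qS2 pq]]] : 1 < #|S2| by rewrite cS2 addn2.
have [D DS1 cD] : exists2 D : {set P}, D \subset S1 & #|D| = d.
  by apply: subset_of_card; rewrite cS1 -addnBA // leq_addr.
pose S := S2 :\ p :\ q; pose T := S1 :\: D.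
have S2S1 y : y \in S2 -> (y \in S1) = false by apply: disjointFl.
have S2D y : y \in S2 -> (y \in D) = false.
  by move/S2S1; apply: contraFF; apply: (subsetP DS1).
have cS : #|S| = u.
  apply: (can_inj (addnK 2)); rewrite -cS2 (cardsD1 p S2) pS2 (cardsD1 q (S2 :\ p)).
  by rewrite !inE eq_sym pq qS2 addnC.
(* Since [0 < c], the truncated subtraction in [d + c - 1] is exact, and one conflict is left in the
   budget for [{p, q}]. *)
have cT : #|T| = c.-1.
  by rewrite cardsD (setIidPr DS1) cS1 cD -addnBA // addKn subn1.
have pS : p \notin S by rewrite !inE eqxx andbF.
have pT : p \notin T by rewrite inE S2S1 ?andbF.
have pqT : p \notin q |: T by rewrite in_setU1 negb_or pq.
have SD : [disjoint S & D].
  by apply/disjoint_setsP => y; rewrite !inE => /and3P[_ _ /S2D->].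
have ST : [disjoint S & T].
  by apply/disjoint_setsP => y; rewrite !inE => /and3P[_ _ /S2S1->]; rewrite andbF.
have SqT : [disjoint S & q |: T].
  apply/disjoint_setsP => y yS; rewrite in_setU1 (disjointFr ST yS) orbF.
  by move: yS; rewrite !inE => /andP[].
have pD : p \notin D by rewrite S2D.
have qD : q \notin D by rewrite S2D.
have cqT : #|q |: T| <= c.
  by rewrite -(prednK c0) cardsU1 cT -[c.-1.+1]add1n leq_add // leq_b1.
have adm1 : admissible x (star_repository P p D S T).
  by apply: admissible_star; rewrite ?cD ?cS ?cT ?leq_pred.
have adm2 : admissible x (star_repository P p D S (q |: T)).
  by apply: admissible_star; rewrite ?cD ?cS.
apply/exists_inP; apply: contraT => noI.
have same_answers I : I \in queries A x ->
    successful (star_repository P p D S T) I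
      = successful (star_repository P p D S (q |: T)) I.
  (* The answers can differ only if [I] contains [p], [S] and [q] and avoids [D] and [T]. Such an
     [I] contains [S2] and avoids [S1], which [noI] excludes. *)
  move=> IQ; rewrite !successful_star; case ID: [disjoint I & D] => //=.
  case pI: (p \in I) => //=; case SI: (S \subset I) => //=.
  rewrite !(disjoint_sym I) !disjoints_subset subUset sub1set inE.
  rewrite -!disjoints_subset.
  case TI: [disjoint T & I]; rewrite ?andbF // andbT; apply/esym.
  apply: contraNN noI => qI; apply/existsP; exists I; rewrite IQ /=.
  apply/andP; split; last first.
    apply/subsetP => y yS2; case: (eqVneq y p) => [->//|yp].
    case: (eqVneq y q) => [->//|yq].
    by apply: (subsetP SI); rewrite !inE yq yp.
  apply/disjoint_setsP => y yI; apply/negP => yS1.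
  have := disjointFl TI yI; rewrite inE yS1 andbT.
  by rewrite (disjointFr ID yI).
have /(congr1 (@graph_conflicts P)) /= eq_conf : full_graph (star_repository P p D S T)
    = full_graph (star_repository P p D S (q |: T)).
  rewrite -(solA _ adm1) -(solA _ adm2); congr output.
  by apply/setP => I; rewrite !inE; apply: andb_id2l; apply: same_answers.
have : [set p; q] \in weak_conflicts (star_repository P p D S (q |: T)).
  apply/imsetP; exists (p, q) => //; rewrite inE pq /=.
  apply/existsPn => I; apply/negP => /and3P[].
  rewrite successful_star => /andP[_ /implyP sI] /sI /andP[_ IqT] qI.
  by have := disjointFr IqT qI; rewrite setU11.
rewrite -eq_conf => pqconf.
(* As [p] and [q] are non-defects, their weak conflict would have to be declared in the first
   repository, forcing [q] into [T] and hence into [S1]. *)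
have : [set p; q] \in conflicts (star_repository P p D S T).
  apply: (subsetP (weak_conflicts_star _ _ _ _ _ pS pT SD ST)).
  rewrite inE pqconf; apply/disjoint_setsP => y.
  by rewrite !inE => /orP[]/eqP->.
case/imsetP=> t tT /setP/(_ q); rewrite !inE eqxx orbT eq_sym (negPf pq) /=.
by move=> /esym/eqP qt; rewrite -qt inE S2S1 ?andbF in tT.
Qed.

Theorem theorem13 (n d u c : nat) (P : finType) (A : nonadaptive_algorithm P) :
  #|P| = n -> 0 < c ->
  solves_full_learning A (Instance set0 d u c) ->
  cff_size n (d + c - 1) (u + 2) <= #|queries A (Instance set0 d u c)|.
Proof.
move=> cP c0 solA; subst n.
(* The characteristic vectors of the queries, with packages numbered by [enum_val]: a query that
   avoids [S1] and contains [S2] is a vector that is 0 on [S1] and 1 on [S2]. *)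
pose F := [set [ffun i : 'I_#|P| => enum_val i \in I]
          | I : {set P} in queries A (Instance set0 d u c)].
apply: leq_trans (leq_imset_card _ _ : #|F| <= _).
have [_ ->//] := cff_sizeP #|P| (d + c - 1) (u + 2).
apply/forallP => S1; apply/forallP => S2.
apply/implyP => /and3P[S12 /eqP cS1 /eqP cS2].
have ev_inj : injective (@enum_val P P) by apply: enum_val_inj.
have [I IQ /andP[IS1 IS2]] : exists2 I, I \in queries A (Instance set0 d u c)
    & [disjoint I & enum_val @: S1] && (enum_val @: S2 \subset I).
  by apply: full_learning_query; rewrite ?card_imset ?imset_disjoint.
apply/exists_inP; exists [ffun i => enum_val i \in I]; first exact: imset_f.
apply/andP; split; apply/forall_inP => i iS; rewrite ffunE.
  by rewrite (disjointFl IS1) // imset_f.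
by rewrite (subsetP IS2) // imset_f.
Qed.
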